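(* Let $T:\mathbb{R}^n\to \mathcal{P}(\mathbb{R}^n)$ be a multivalued map that is $h$-monotone. Then the set $$S=\{p\in \mathbb{R}^n: \text{there exist } x,y\in \mathbb{R}^n,\ x\neq y,\ \text{such that } p\in T(x)\cap T(y)\}$$ has Lebesgue measure zero.
   Context: Standing assumptions on the cost: $h\in C^2(\mathbb{R}^n)$ is real-valued, nonnegative, and positively homogeneous of degree $q$ for some real $q\ge 2$ (i.e. $h(tx)=t^q h(x)$ for $t>0$), and its Hessian $D^2h(x)$ is positive definite for each $x$ in the unit sphere $S^{n-1}$; equivalently there are constants $\lambda,\Lambda>0$ such that $\lambda|v|^2\le \langle D^2h(x)v,v\rangle\le \Lambda|v|^2$ for all $x\in S^{n-1}$, $v\in\mathbb{R}^n$. $\mathcal{P}(\mathbb{R}^n)$ is the set of all subsets of $\mathbb{R}^n$ (so $T(x)$ may be empty). The domain of $T$ is $\mathrm{dom}(T)=\{x\in\mathbb{R}^n: T(x)\neq\emptyset\}$. The map $T$ is $h$-monotone if $$h(x-\xi)+h(y-\zeta)\le h(x-\zeta)+h(y-\xi)$$ for all $x,y\in\mathrm{dom}(T)$, all $\xi\in T(x)$ and all $\zeta\in T(y)$. *)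

(* Defs.v *)
From HB Require Import structures.
From mathcomp Require Import all_boot all_order all_algebra.
From mathcomp Require Import all_classical all_reals all_analysis.
Set Implicit Arguments.
Unset Strict Implicit.
Unset Printing Implicit Defensive.
Import Order.TTheory GRing.Theory Num.Theory.
Import numFieldNormedType.Exports.
Local Open Scope classical_set_scope.
Local Open Scope ring_scope.

(* The norm that the library puts on 'rV[R]_n is the sup norm; it induces the
   usual topology of R^n, but the unit sphere has to be the Euclidean one. *)

Definition unit_sphere (R : realType) (n : nat) : set 'rV[R]_n :=
  [set x | Num.sqrt (\sum_(i < n) x ord0 i ^+ 2) = 1].

Definition partial (R : realType) (n : nat) (i : 'I_n) (f : 'rV[R]_n -> R) :
  'rV[R]_n -> R := fun x => 'D_(delta_mx ord0 i) f x.

(* The derivative operator is total: existence of the partial derivatives has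
   to be required separately. *)
Definition C1 (R : realType) (n : nat) (f : 'rV[R]_n -> R) : Prop :=
  continuous f /\
  forall i : 'I_n, (forall x, derivable f x (delta_mx ord0 i)) /\
                   continuous (partial i f).

Definition C2 (R : realType) (n : nat) (f : 'rV[R]_n -> R) : Prop :=
  C1 f /\ forall i : 'I_n, C1 (partial i f).

Definition hessian (R : realType) (n : nat) (f : 'rV[R]_n -> R)
    (x : 'rV[R]_n) : 'M[R]_n :=
  \matrix_(i < n, j < n) partial i (partial j f) x.

(* Symmetry is not part of the definition: the Hessian of a C^2 function is
   symmetric. *)
Definition posdef (R : realType) (n : nat) (A : 'M[R]_n) : Prop :=
  forall v : 'rV[R]_n, v != 0 -> 0 < (v *m A *m v^T) ord0 ord0.

Definition pos_homogeneous (R : realType) (n : nat) (q : R)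
    (f : 'rV[R]_n -> R) : Prop :=
  forall (t : R) (x : 'rV[R]_n), 0 < t -> f (t *: x) = t `^ q * f x.

Definition dom (R : realType) (n : nat) (T : 'rV[R]_n -> set 'rV[R]_n) :
  set 'rV[R]_n := [set x | T x !=set0].

Definition h_monotone (R : realType) (n : nat) (h : 'rV[R]_n -> R)
    (T : 'rV[R]_n -> set 'rV[R]_n) : Prop :=
  forall x y xi zeta : 'rV[R]_n, dom T x -> dom T y -> T x xi -> T y zeta ->
    h (x - xi) + h (y - zeta) <= h (x - zeta) + h (y - xi).

Definition box (R : realType) (n : nat) (a b : 'rV[R]_n) : set 'rV[R]_n :=
  [set x | forall i, a ord0 i <= x ord0 i <= b ord0 i].

(* The library has Lebesgue measure on R only.  On R^n we take the Lebesgue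
   outer measure: the infimum of the total volumes of the at most countable
   covers by compact boxes.  A set has Lebesgue measure zero iff its outer
   measure is zero (it is then Lebesgue measurable).  The index set D allows
   finite and empty covers, so that the empty set is null also for n = 0. *)
Definition lebesgue_outer (R : realType) (n : nat) (A : set 'rV[R]_n) :
    \bar R :=
  ereal_inf [set v | exists (D : set nat) (a b : nat -> 'rV[R]_n),
    [/\ forall k i, a k ord0 i <= b k ord0 i,
        A `<=` \bigcup_(k in D) box (a k) (b k) &
        v = (\esum_(k in D)
               (\prod_(i < n) (b k ord0 i - a k ord0 i))%:E)%E]].

Definition lebesgue_null (R : realType) (n : nat) (A : set 'rV[R]_n) : Prop :=
  lebesgue_outer A = 0%E.

(* Main.v *)
Require Import Defs.
From HB Require Import structures.
From mathcomp Require Import all_boot all_order all_algebra.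
From mathcomp Require Import all_classical all_reals all_analysis.
From mathcomp Require Import ring lra.
Import Order.TTheory GRing.Theory Num.Theory.
Import numFieldNormedType.Exports.
Local Open Scope classical_set_scope.
Local Open Scope ring_scope.

(** Let p be a common value of T at x and y, x <> y.  Applying h-monotonicity
    to the pairs (x1, p1) and (y2, p2), and rearranging, gives
      h (x1 - p1) - h (x1 - p2) <= h (y2 - p1) - h (y2 - p2).
    If all of these points are close to x, y and p, both sides are increments
    of h along p2 - p1, taken near x - p and near y - p.  A C^1 function is
    strictly differentiable ([C1_strict_diff]: two moving points near z, not
    only z and one moving point), so with w := grad h (x - p) - grad h (y - p)
    the inequality becomes <w, p2 - p1> <= eps |p2 - p1|.  When p1 and p2 are
    both common values, the roles of 1 and 2 can be exchanged, hence
    |<w, p2 - p1>| <= eps |p2 - p1|.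

    The vector w is not zero: by homogeneity the Hessian of h is positive
    definite away from the origin, and a segment meets the origin
    at most once, so h is strictly convex along segments and its gradient is
    injective ([grad_injective]).  With eps small against a nonzero coordinate
    w_k, the bound says that the common values near p whose witnesses are near
    x and y form a Lipschitz graph over the coordinates other than k
    ([collision_locally_null]).  A bounded Lipschitz graph is null: a grid of
    step s has of order s^-(n-1) cells, and over each of them the graph fits in
    a box of volume of order s^n ([lipschitz_graph_null]).

    Finally the triples (p, x, y) live in a separable space, so countably many
    of these local null sets cover everything ([locally_lebesgue_null]). *)

(** * The sup norm on row vectors *)

Lemma row_norm_leP {R : realType} {n : nat} (d : 'rV[R]_n) (e : R) :
  0 <= e -> reflect (forall i, `|d ord0 i| <= e) (`|d| <= e).
Proof.
move=> e0; rewrite [`|d|]mx_normrE; apply: (iffP idP) => [le_e i|le_e].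
  apply: le_trans le_e; exact: (le_bigmax _ (fun ij => `|d ij.1 ij.2|) (ord0, i)).
by apply: bigmax_le => // -[j i] _ /=; rewrite ord1.
Qed.

Lemma row_norm_ltP {R : realType} {n : nat} (d : 'rV[R]_n) (e : R) :
  0 < e -> reflect (forall i, `|d ord0 i| < e) (`|d| < e).
Proof.
move=> e0; rewrite [`|d|]mx_normrE; apply: (iffP idP) => [lt_e i|lt_e].
  apply: le_lt_trans lt_e; exact: (le_bigmax _ (fun ij => `|d ij.1 ij.2|) (ord0, i)).
by apply: bigmax_lt => // -[j i] _ /=; rewrite ord1.
Qed.

Lemma coord_norm_le {R : realType} {n : nat} (d : 'rV[R]_n) i : `|d ord0 i| <= `|d|.
Proof. by move: i; apply/row_norm_leP. Qed.

(** * Strict differentiability of C^1 functions *)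

Lemma is_derive_line {R : realType} {n : nat} (f : 'rV[R]_n -> R)
    (w v : 'rV[R]_n) (t : R) :
  derivable f (w + t *: v) v ->
  is_derive t 1 (fun s : R => f (w + s *: v)) ('D_v f (w + t *: v)).
Proof.
have quotE : (fun s : R => s^-1 *: (((fun r : R => f (w + r *: v)) \o shift t)
      (s *: (1 : R)) - f (w + t *: v)))
  = (fun s : R => s^-1 *: ((f \o shift (w + t *: v)) (s *: v) - f (w + t *: v))).
  apply/funext => s /=; congr (_ *: (f _ - _)).
  by rewrite [s *: 1]mulr1 scalerDl addrCA.
by move=> f_drv; split; rewrite /derivable/derive /= quotE.
Qed.

(** The differential of f at z in the direction d, written with partial
    derivatives so that it is linear in d by construction; the derivative
    along d need not be linear in d for a function that merely has partial
    derivatives. *)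
Definition dir_deriv {R : realType} {n : nat} (f : 'rV[R]_n -> R) (z d : 'rV[R]_n) : R :=
  \sum_(i < n) d ord0 i * partial i f z.

(** The intermediate parameter lies between 0 and s, with either sign of s:
    the point where the partial derivative is taken then stays in every box
    that contains both end points. *)
Lemma C1_MVT_axis {R : realType} {n : nat} (f : 'rV[R]_n -> R) (k : 'I_n)
    (w : 'rV[R]_n) (s : R) : C1 f ->
  exists2 c : R, (0 <= c <= s) || (s <= c <= 0) &
    f (w + s *: delta_mx ord0 k) - f w = s * partial k f (w + c *: delta_mx ord0 k).
Proof.
move=> [f_cont f_part]; have [f_drv _] := f_part k.
pose g (t : R) := f (w + t *: delta_mx ord0 k).
have g_drv (t : R) : is_derive t (1 : R) g (partial k f (w + t *: delta_mx ord0 k)).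
  exact: is_derive_line.
have g_cont (a b : R) : {within `[a, b], continuous g}.
  by apply: derivable_within_continuous => t _; case: (g_drv t).
have g0 : g 0 = f w by rewrite /g scale0r addr0.
have [s0|s0] := leP 0 s.
  have [c] := MVT_segment s0 (fun t (_ : _) => g_drv t) (g_cont _ _).
  rewrite in_itv /= => /andP[c0 cs]; rewrite g0 subr0 mulrC => gs.
  by exists c; rewrite // c0 cs.
have [c] := MVT_segment (ltW s0) (fun t (_ : _) => g_drv t) (g_cont _ _).
rewrite in_itv /= => /andP[sc c0]; rewrite g0 sub0r => gs.
exists c; first by rewrite sc c0 orbT.
by rewrite -[LHS]opprB [f w - _]gs mulrN opprK mulrC.
Qed.

(** Pass from z' to z by changing one coordinate at a time.  The mean value
    theorem evaluates each step with a partial derivative at a point of the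
    same sup-norm ball, where by continuity it is close to its value at z0. *)
Lemma C1_strict_diff {R : realType} {n : nat} (f : 'rV[R]_n -> R)
    (z0 : 'rV[R]_n) (e : R) : C1 f -> 0 < e ->
  exists2 r : R, 0 < r & forall z z', `|z - z0| < r -> `|z' - z0| < r ->
    `|f z - f z' - dir_deriv f z0 (z - z')| <= e * `|z - z'|.
Proof.
move=> f_C1 e0.
(* the n coordinate errors must add up to e; n.+1 also covers n = 0 *)
pose e' := e / n.+1%:R.
have e'0 : 0 < e' by rewrite divr_gt0.
have /filter_forall near_part : forall k : 'I_n, \forall z \near z0,
    `|partial k f z0 - partial k f z| <= e'.
  move=> k; have [_ part_cont] := f_C1.2 k.
  by move: (part_cont z0) => /cvgrPdist_le/(_ e' e'0).
have /nbhs_normP[r /= r0 r_part] := near_part.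
exists r => // z z' zr z'r.
(* w k has its first k coordinates from z and the others from z' *)
pose w (k : nat) : 'rV[R]_n := \row_(i < n) if (i < k)%N then z ord0 i else z' ord0 i.
have w0 : w 0 = z' by apply/rowP => i; rewrite mxE.
have wn : w n = z by apply/rowP => i; rewrite mxE ltn_ord.
have wS (k : 'I_n) : w k.+1 = w k + (z - z') ord0 k *: delta_mx ord0 k.
  apply/rowP => i; rewrite !mxE eqxx /= ltnS leq_eqVlt -(inj_eq val_inj).
  have [/ord_inj ->|ki] := eqVneq (i : nat) k; last by rewrite mulr0 addr0.
  by rewrite ltnn mulr1 addrC subrK.
have telescope : f z - f z' = \sum_(k < n) (f (w k.+1) - f (w k)).
  by rewrite -{1}wn -w0 -(telescope_sumr (fun k => f (w k)) (leq0n n)) big_mkord.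
rewrite telescope -sumrB (le_trans (ler_norm_sum _ _ _)) //.
have step (k : 'I_n) : `|f (w k.+1) - f (w k) - (z - z') ord0 k * partial k f z0|
    <= `|z - z'| * e'.
  rewrite wS; have [c cs ->] := C1_MVT_axis f k (w k) ((z - z') ord0 k) f_C1.
  rewrite -mulrBr normrM ler_pM ?coord_norm_le // distrC.
  apply: (r_part (w k + c *: delta_mx ord0 k)); rewrite /ball_/=.
  apply/row_norm_ltP => // i; rewrite !mxE eqxx /=.
  have {}zr : `|z ord0 i - z0 ord0 i| < r.
    by have /row_norm_ltP/(_ i) := zr; rewrite !mxE => ->.
  have {}z'r : `|z' ord0 i - z0 ord0 i| < r.
    by have /row_norm_ltP/(_ i) := z'r; rewrite !mxE => ->.
  have [ik|ik] := eqVneq i k; last first.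
    by rewrite mulr0 addr0; case: ifP => _; rewrite distrC.
  rewrite ik in zr z'r *; rewrite ltnn mulr1.
  move: cs zr z'r; rewrite !mxE; set a := z ord0 k; set b := z' ord0 k.
  rewrite !ltr_norml => /orP[]/andP[? ?] /andP[? ?] /andP[? ?];
    apply/andP; split; lra.
apply: (le_trans (ler_sum _ (fun k _ => step k))).
rewrite sumr_const card_ord -mulrnAr mulrC ler_wpM2r //.
by rewrite -mulr_natr /e' mulrAC ler_pdivrMr // ler_wpM2l ?ler_nat // ltW.
Qed.

(** The case of strict differentiability where one of the two points is the
    base point; it gives the chain rule along a line. *)
Lemma is_derive_C1 {R : realType} {n : nat} (f : 'rV[R]_n -> R)
    (b v : 'rV[R]_n) (t : R) : C1 f ->
  is_derive t (1 : R) (fun s : R => f (b + s *: v)) (dir_deriv f (b + t *: v) v).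
Proof.
move=> f_C1; set z := b + t *: v; set L := dir_deriv f z v.
suff quot_cvg : (fun s : R => s^-1 *: (((fun r : R => f (b + r *: v)) \o shift t)
      (s *: (1 : R)) - f z)) @ 0^' --> L.
  by split; [apply/cvg_ex; exists L | exact/cvg_lim].
apply/cvgrPdist_le => e e0.
have e'0 : 0 < e / (`|v| + 1) by rewrite divr_gt0 // ltr_wpDl.
have [r r0 f_near] := C1_strict_diff f z _ f_C1 e'0.
have r'0 : 0 < r / (`|v| + 1) by rewrite divr_gt0 // ltr_wpDl.
near=> s.
have s_neq0 : s != 0 by near: s; exact: nbhs_dnbhs_neq.
have s_small : `|s| < r / (`|v| + 1) by near: s; exact: dnbhs0_lt.
have -> : ((fun r : R => f (b + r *: v)) \o shift t) (s *: (1 : R)) = f (z + s *: v).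
  by rewrite /= [s *: 1]mulr1 scalerDl addrA addrAC.
have gradZ : dir_deriv f z (s *: v) = s * L.
  by rewrite /L /dir_deriv mulr_sumr; apply: eq_bigr => i _; rewrite !mxE mulrA.
have := f_near (z + s *: v) z; rewrite subrr normr0 addrC addKr gradZ normrZ.
have -> : `|s| * `|v| < r.
  have := s_small; rewrite ltr_pdivlMr ?ltr_wpDl // => /(le_lt_trans _); apply.
  by rewrite ler_wpM2l // lerDl.
move=> /(_ isT r0) near_sL.
rewrite -(ler_pM2l (_ : 0 < `|s|)) ?normr_gt0 // -normrM mulrBr [s * (_ *: _)]mulVKf //.
rewrite distrC (le_trans near_sL) // mulrCA ler_wpM2l // mulrAC ler_pdivrMr ?ltr_wpDl //.
by rewrite ler_wpM2l ?lerDl // ltW.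
Unshelve. all: by end_near. Qed.

(** * Injectivity of the gradient of a homogeneous cost *)

(** Differentiate s |-> f (t x + s t e_k) at s = 0 in two ways: directly it
    gives t * partial k f (t x); after extracting t `^ q by homogeneity it
    gives t `^ q * partial k f x. *)
Lemma pos_homogeneous_partial {R : realType} {n : nat} (q : R)
    (f : 'rV[R]_n -> R) (k : 'I_n) :
  C1 f -> pos_homogeneous q f -> pos_homogeneous (q - 1) (partial k f).
Proof.
move=> f_C1 f_hom t x t0.
have scaled_drv : is_derive (0 : R) (1 : R)
    (fun s : R => f (t *: x + s *: (t *: delta_mx ord0 k))) (t * partial k f (t *: x)).
  have := is_derive_C1 f (t *: x) (t *: delta_mx ord0 k) 0 f_C1.
  rewrite scale0r addr0 /dir_deriv (bigD1 k) //= big1 ?addr0; last first.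
    by move=> i ik; rewrite !mxE (negPf ik) andbF mulr0 mul0r.
  by rewrite !mxE !eqxx mulr1.
have base_drv : is_derive (0 : R) (1 : R)
    (fun s : R => f (x + s *: delta_mx ord0 k)) (partial k f x).
  have := @is_derive_line _ _ f x (delta_mx ord0 k) 0.
  by rewrite scale0r addr0; apply; exact: (f_C1.2 k).1.
have [_ baseE] := is_deriveZ (t `^ q) base_drv.
have [_ scaledE] := scaled_drv.
have homE : (fun s : R => f (t *: x + s *: (t *: delta_mx ord0 k))) =
    t `^ q \*: (fun s : R => f (x + s *: delta_mx ord0 k)).
  apply/funext => s /=; rewrite -[RHS]f_hom //; congr f.
  by rewrite scalerDr !scalerA mulrC.
apply: (mulfI (lt0r_neq0 t0)); rewrite -scaledE homE baseE mulrA.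
by rewrite -{2}[t]powRr1 ?ltW // -powRD ?(lt0r_neq0 t0) ?implybT // addrC subrK.
Qed.

(** The Hessian is homogeneous of degree q - 2, hence a positive multiple of
    its value at the projection of x on the unit sphere. *)
Lemma posdef_hessian_off0 {R : realType} {n : nat} (q : R) (h : 'rV[R]_n -> R) :
    C2 h -> pos_homogeneous q h ->
    (forall x, unit_sphere x -> posdef (hessian h x)) ->
  forall x, x != 0 -> posdef (hessian h x).
Proof.
move=> [h_C1 h_C2] h_hom h_sphere x x_neq0.
set r := Num.sqrt (\sum_(i < n) x ord0 i ^+ 2).
have sq_ge0 : 0 <= \sum_(i < n) x ord0 i ^+ 2 by apply: sumr_ge0 => i _; exact: sqr_ge0.
have r_gt0 : 0 < r.
  rewrite sqrtr_gt0 lt_def sq_ge0 andbT; apply: contra x_neq0 => /eqP sum0.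
  apply/eqP/rowP => i; rewrite mxE; apply/eqP; rewrite -sqrf_eq0; apply/eqP.
  by move: sum0 => /psumr_eq0P -> // j _; exact: sqr_ge0.
have u_sphere : unit_sphere (r^-1 *: x).
  rewrite /unit_sphere /=; under eq_bigr do rewrite mxE exprMn.
  rewrite -mulr_sumr -[X in _ * X]sqr_sqrtr // -/r -exprMn mulVf ?lt0r_neq0 //.
  by rewrite expr1n sqrtr1.
have hessE : hessian h x = r `^ (q - 1 - 1) *: hessian h (r^-1 *: x).
  apply/matrixP => i j; rewrite !mxE.
  rewrite -(pos_homogeneous_partial _ _ i (h_C2 j)
    (pos_homogeneous_partial _ _ j h_C1 h_hom) r) //.
  by rewrite scalerA divff ?scale1r ?lt0r_neq0.
move=> v v_neq0; rewrite hessE -scalemxAr -scalemxAl mxE.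
by rewrite mulr_gt0 ?powR_gt0 // h_sphere.
Qed.

(** With v := a - b, the function g t := <grad h (b + t v), v> has the
    derivative <D^2 h (b + t v) v, v>, which is positive except possibly at the
    single t0 where the segment passes through the origin.  The mean value
    theorem on either side of t0 yields g 0 < g 1, so the gradients at a and b
    differ. *)
Lemma grad_injective {R : realType} {n : nat} (h : 'rV[R]_n -> R) (a b : 'rV[R]_n) :
    C2 h -> (forall x, x != 0 -> posdef (hessian h x)) -> a != b ->
  exists k, partial k h a != partial k h b.
Proof.
move=> [h_C1 h_C2] h_pos ab; apply/not_existsP => grad_eq.
set v := a - b; have v_neq0 : v != 0 by rewrite subr_eq0.
pose g (t : R) := dir_deriv h (b + t *: v) v.
pose g' (t : R) := (v *m hessian h (b + t *: v) *m v^T) ord0 ord0.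
have g_drv (t : R) : is_derive t (1 : R) g (g' t).
  have -> : g = \sum_(j < n) (v ord0 j \*: (fun s : R => partial j h (b + s *: v))).
    by apply/funext => s; rewrite fct_sumE.
  have -> : g' t = \sum_(j < n) v ord0 j *: dir_deriv (partial j h) (b + t *: v) v.
    rewrite /g' mxE; apply: eq_bigr => j _; rewrite [LHS]mulrC.
    rewrite [v^T _ _]mxE [(v *m _) _ _]mxE; congr (_ * _).
    by apply: eq_bigr => i _; rewrite [hessian _ _ _ _]mxE.
  by apply: is_derive_sum => j; apply: is_deriveZ; exact: is_derive_C1.
have g_cont (c d : R) : {within `[c, d], continuous g}.
  by apply: derivable_within_continuous => t _; case: (g_drv t).
have g01 : g 0 = g 1.
  have bvE : b + v = a by rewrite addrC subrK.
  rewrite /g scale0r addr0 scale1r bvE; apply: eq_bigr => k _.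
  by congr (_ * _); apply/esym/eqP/negPn/negP; exact: grad_eq.
have g_incr (c d : R) : c < d ->
    (forall t, c < t < d -> b + t *: v != 0) -> g c < g d.
  move=> cd off0; have [t] := MVT cd (fun t (_ : _) => g_drv t) (g_cont _ _).
  rewrite in_itv /= => /off0/h_pos/(_ _ v_neq0) g't_gt0 gE.
  by rewrite -subr_gt0 gE mulr_gt0 // subr_gt0.
have [[t0 /andP[t0_gt0 t0_lt1] t0_zero]|no_zero] :=
    pselect (exists2 t : R, 0 < t < 1 & b + t *: v = 0); last first.
  suff : g 0 < g 1 by rewrite g01 ltxx.
  apply: g_incr => // t t01; apply/negP => /eqP t_zero; apply: no_zero.
  by exists t.
have off0 (t : R) : t != t0 -> b + t *: v != 0.
  apply: contra => /eqP; rewrite -t0_zero => /addrI/eqP.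
  by rewrite -subr_eq0 -scalerBl scaler_eq0 (negPf v_neq0) orbF subr_eq0.
suff : g 0 < g 1 by rewrite g01 ltxx.
apply: (@lt_trans _ _ (g t0)); apply: g_incr => // t /andP[t1 t2].
  by rewrite off0 ?lt_eqF.
by rewrite off0 ?gt_eqF.
Qed.

(** * Null sets *)

Definition volume {R : realType} {n : nat} (a b : 'rV[R]_n) : R :=
  \prod_(i < n) (b ord0 i - a ord0 i).

Lemma volume_ge0 {R : realType} {n : nat} (a b : 'rV[R]_n) :
  (forall i, a ord0 i <= b ord0 i) -> 0 <= volume a b.
Proof. by move=> ab; apply: prodr_ge0 => i _; rewrite subr_ge0. Qed.

(** Indexing the covers by any choice type, and not only by natural numbers,
    lets a countable union use pairs and a grid use its cells. *)
Definition box_cover {R : realType} {n : nat} {I : choiceType} (D : set I)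
    (a b : I -> 'rV[R]_n) (A : set 'rV[R]_n) (e : \bar R) : Prop :=
  [/\ forall k i, a k ord0 i <= b k ord0 i,
      A `<=` \bigcup_(k in D) box (a k) (b k) &
      (\esum_(k in D) (volume (a k) (b k))%:E <= e)%E].

Lemma lebesgue_null_covers {R : realType} {n : nat} (A : set 'rV[R]_n) (e : R) :
  lebesgue_null A -> 0 < e ->
  exists (D : set nat) (a b : nat -> 'rV[R]_n), box_cover D a b A e%:E.
Proof.
move=> A_null e0.
have : (lebesgue_outer A < e%:E)%E by rewrite A_null lte_fin.
move=> /ereal_inf_lt[_ [D [a [b [ab Acov ->]]]] lt_e].
by exists D, a, b; split => //; exact: ltW.
Qed.

Lemma covers_lebesgue_null {R : realType} {n : nat} (A : set 'rV[R]_n) :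
  (forall e : R, 0 < e ->
     exists (I : countType) (D : set I) (a b : I -> 'rV[R]_n),
       box_cover D a b A e%:E) ->
  lebesgue_null A.
Proof.
move=> A_cov; apply/eqP; rewrite eq_le; apply/andP; split; last first.
  apply: le_ereal_inf_tmp => _ [D [a [b [ab _ ->]]]].
  by apply: esum_ge0 => k _; rewrite lee_fin volume_ge0.
apply/lee_addgt0Pr => e e0; rewrite add0e.
have [I [D [a [b [ab Acov vol_le]]]]] := A_cov e e0.
pose lift_nat (c : I -> 'rV[R]_n) (k : nat) : 'rV[R]_n := oapp c 0 (unpickle k).
apply: le_trans vol_le; apply: ereal_inf_lbound => /=.
exists (pickle @` D), (lift_nat a), (lift_nat b); split.
- by move=> k i; rewrite /lift_nat; case: (unpickle k) => /=.
- move=> p /Acov[k Dk pk]; exists (pickle k); first by exists k.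
  by rewrite /lift_nat pickleK.
- rewrite esum_image; last by move=> i j _ _; exact: (pcan_inj pickleK).
  by apply: eq_esum => k _; rewrite /lift_nat pickleK.
Qed.

Lemma sub_lebesgue_null {R : realType} {n : nat} (A B : set 'rV[R]_n) :
  A `<=` B -> lebesgue_null B -> lebesgue_null A.
Proof.
move=> AB B_null; apply: covers_lebesgue_null => e e0.
have [D [a [b [ab Bcov vol_le]]]] := lebesgue_null_covers _ _ B_null e0.
by exists nat, D, a, b; split => //; exact: subset_trans Bcov.
Qed.

Lemma esum_geometric {R : realType} {I : countType} (e : R) : 0 <= e ->
  (\esum_(i in [set: I]) (e / (2 ^ (pickle i).+1)%:R)%:E <= e%:E)%E.
Proof.
move=> e0; rewrite -(esum_image setT pickle (fun k => (e / (2 ^ k.+1)%:R)%:E)); last first.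
  by move=> i j _ _; exact: (pcan_inj pickleK).
apply: le_trans (epsilon_trick0 xpredT e0); rewrite nneseries_esumT; last first.
  by move=> k; rewrite lee_fin divr_ge0.
rewrite esum_mkcond; apply: le_esum => k _; case: ifP => // _.
by rewrite lee_fin divr_ge0.
Qed.

Lemma bigcup_lebesgue_null {R : realType} {n : nat} {I : countType}
    (F : I -> set 'rV[R]_n) :
  (forall i, lebesgue_null (F i)) -> lebesgue_null (\bigcup_i F i).
Proof.
move=> F_null; apply: covers_lebesgue_null => e e0.
have cover_i (i : I) : exists x : set nat * (nat -> 'rV[R]_n) * (nat -> 'rV[R]_n),
    box_cover x.1.1 x.1.2 x.2 (F i) (e / (2 ^ (pickle i).+1)%:R)%:E.
  have ei_gt0 : 0 < e / (2 ^ (pickle i).+1)%:R by rewrite divr_gt0 // ltr0n expn_gt0.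
  have [D [a [b cov]]] := lebesgue_null_covers _ _ (F_null i) ei_gt0.
  by exists (D, a, b).
have [x x_cov] := choice cover_i.
exists (I * nat)%type, (setT `*`` (fun i => (x i).1.1)),
  (fun k => (x k.1).1.2 k.2), (fun k => (x k.1).2 k.2); split.
- by move=> [i k] j /=; case: (x_cov i).
- move=> p [i _ /=]; have [_ cov _] := x_cov i => /cov[k Dk pk].
  by exists (i, k).
- rewrite -(esum_esum (a := fun i k => (volume ((x i).1.2 k) ((x i).2 k))%:E)); last first.
    by move=> i k _ _; rewrite lee_fin volume_ge0 //; case: (x_cov i).
  apply: le_trans (esum_geometric e (ltW e0)).
  by apply: le_esum => i _; case: (x_cov i).
Qed.

Lemma rational_row_dense {R : realType} {n : nat} (z : 'rV[R]_n) (r : R) :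
  0 < r -> exists c : 'rV[rat]_n, `|z - map_mx ratr c| < r.
Proof.
move=> r0.
have near_i (i : 'I_n) : exists c : rat, `|z ord0 i - ratr c| < r.
  have /rat_in_itvoo[c] : z ord0 i - r < z ord0 i + r by rewrite ltrD2l gtrN.
  rewrite in_itv /= => /andP[c1 c2]; exists c.
  by rewrite ltr_norml; apply/andP; split; lra.
have [c c_near] := choice near_i.
exists (\row_i c i); apply/row_norm_ltP => // i.
by rewrite !mxE.
Qed.

(** A Lindelof argument for a set parametrized by witnesses z in a separable
    normed space: the balls of radius 1 / (m + 1) around the dense points c i
    are countably many, and those whose set of witnessed points is null
    already reach every witness. *)
Lemma locally_lebesgue_null {R : realType} {n : nat} {V : normedModType R}
    {I : countType} (c : I -> V) (G : V -> 'rV[R]_n -> Prop) :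
    (forall z r, 0 < r -> exists i, `|z - c i| < r) ->
    (forall z p, G z p -> exists2 r : R, 0 < r &
       lebesgue_null [set p' | exists2 z', `|z - z'| < r & G z' p']) ->
  lebesgue_null [set p | exists z, G z p].
Proof.
move=> c_dense G_loc.
pose F (x : I * nat) : set 'rV[R]_n :=
  [set p | exists2 z', `|c x.1 - z'| < x.2.+1%:R^-1 & G z' p].
(* the balls whose witnessed set is not null are replaced by the empty set *)
pose F' x := [set p | lebesgue_null (F x) /\ F x p].
apply: (@sub_lebesgue_null _ _ _ (\bigcup_x F' x)); last first.
  apply: bigcup_lebesgue_null => x; have [Fx|nFx] := pselect (lebesgue_null (F x)).
    by apply: sub_lebesgue_null Fx => p [].
  apply: covers_lebesgue_null => e e0; exists nat, set0, (fun=> 0), (fun=> 0).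
  by split => //; [move=> p [] | rewrite esum_set0 lee_fin ltW].
move=> p [z Gzp]; have [r r0 r_null] := G_loc z p Gzp.
have r2 : 0 < r / 2 by rewrite divr_gt0.
have [m m_lt] : exists m : nat, m.+1%:R^-1 < r / 2.
  by have [m _ /(_ m (leqnn m))] := near_infty_natSinv_lt (PosNum r2); exists m.
have m0 : 0 < m.+1%:R^-1 :> R by rewrite invr_gt0.
have [i zi] := c_dense z _ m0.
exists (i, m) => //; split; last by exists z => //; rewrite distrC.
apply: sub_lebesgue_null r_null => p' [z' z'i Gz']; exists z' => //.
rewrite (splitr r) -(subrKA (c i)) (le_lt_trans (ler_normD _ _)) // ltrD //.
  exact: lt_trans zi m_lt.
exact: lt_trans z'i m_lt.
Qed.

(** * Lipschitz graphs *)

(** The hypothesis on differences says that p_k is an L-Lipschitz function of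
    the other n - 1 coordinates.  Cut the cube of half-side K in those into
    (m + 1)^(n - 1) cells of side s = 2 K / (m + 1); over each cell the set
    lies in a slab of thickness 2 L s.  The total volume C / (m + 1), with
    C = 2 L (2 K)^n, tends to 0. *)
Lemma lipschitz_graph_null {R : realType} {n : nat} (k : 'I_n) (K L : R)
    (A : set 'rV[R]_n) :
    0 < K -> 0 < L ->
    (forall p, A p -> forall i, `|p ord0 i| < K) ->
    (forall p p' (D : R), A p -> A p' -> 0 <= D ->
       (forall i, i != k -> `|(p - p') ord0 i| <= D) ->
       `|(p - p') ord0 k| <= L * D) ->
  lebesgue_null A.
Proof.
case: n k A => [[]//|n] k A K0 L0 A_bnd A_lip.
apply: covers_lebesgue_null => e e0.
pose C := L * 2 * (2 * K) * (2 * K) ^+ n.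
have C0 : 0 < C by rewrite !mulr_gt0 // exprn_gt0 // mulr_gt0.
have [m m_lt] : exists m : nat, m.+1%:R^-1 < e / C.
  have eC : 0 < e / C by rewrite divr_gt0.
  by have [m _ /(_ m (leqnn m))] := near_infty_natSinv_lt (PosNum eC); exists m.
pose s := 2 * K / m.+1%:R.
have s0 : 0 < s by rewrite divr_gt0 // mulr_gt0.
pose cell (g : {ffun 'I_n -> 'I_m.+1}) : set 'rV[R]_n.+1 :=
  [set p | A p /\ forall j, - K + (g j)%:R * s <= p ord0 (lift k j) <= - K + (g j).+1%:R * s].
have slab g : exists c : R, forall p, cell g p -> `|p ord0 k - c| <= L * s.
  (* any point of the set in the cell is the centre of a slab *)
  have [[p0 [Ap0 p0_cell]]|no_p] := pselect (exists p, cell g p); last first.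
    by exists 0 => p cell_p; case: no_p; exists p.
  exists (p0 ord0 k) => p [Ap p_cell].
  have := A_lip p p0 s Ap Ap0 (ltW s0); rewrite !mxE; apply => i ik.
  have [j ->|i_eq] := unliftP k i; last by rewrite i_eq eqxx in ik.
  rewrite !mxE ler_norml.
  move: (p0_cell j) (p_cell j); rewrite -[(g j).+1%:R]natr1 => /andP[? ?] /andP[? ?].
  by apply/andP; split; lra.
have [c c_slab] := choice slab.
(* the lower corner is at t = -1, u = 0 and the upper one at t = 1, u = 1 *)
pose corner (t : R) (u : nat) (g : {ffun 'I_n -> 'I_m.+1}) : 'rV[R]_n.+1 :=
  \row_i if unlift k i is Some j then - K + (g j + u)%N%:R * s else c g + t * (L * s).
have corner_k t u g : corner t u g ord0 k = c g + t * (L * s).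
  by rewrite mxE unlift_none.
have corner_lift t u g j : corner t u g ord0 (lift k j) = - K + (g j + u)%N%:R * s.
  by rewrite mxE liftK.
exists {ffun 'I_n -> 'I_m.+1}, setT, (corner (-1) 0), (corner 1 1); split.
- move=> g i; have [j ->|->] := unliftP k i.
    by rewrite !corner_lift lerD2l ler_pM2r // ler_nat leq_add2l.
  by rewrite !corner_k lerD2l ler_pM2r ?mulr_gt0 // gerN.
- move=> p Ap.
  have idx_lt j : (Num.truncn ((p ord0 (lift k j) + K) / s) < m.+1)%N.
    have /ltr_normlP[p1 p2] := A_bnd p Ap (lift k j).
    rewrite truncn_lt_nat; last by apply: divr_ge0; [lra | exact: ltW].
    by rewrite ltr_pdivrMr // /s mulrC divfK //; lra.
  pose g := [ffun j => Ordinal (idx_lt j)].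
  have g_cell j : - K + (g j)%:R * s <= p ord0 (lift k j) <= - K + (g j).+1%:R * s.
    have /ltr_normlP[p1 p2] := A_bnd p Ap (lift k j).
    have := @truncn_itv _ ((p ord0 (lift k j) + K) / s); rewrite ffunE /=.
    have q_ge0 : 0 <= (p ord0 (lift k j) + K) / s.
      by apply: divr_ge0; [lra | exact: ltW].
    move=> /(_ q_ge0); rewrite ler_pdivlMr // ltr_pdivrMr // => /andP[? ?].
    apply/andP; split; lra.
  exists g => // i; have [j ->|->] := unliftP k i.
    by rewrite !corner_lift addn0 addn1 g_cell.
  rewrite !corner_k; have /ler_normlP[? ?] := c_slab g p (conj Ap g_cell).
  by apply/andP; split; lra.
- have vol_cell g : volume (corner (-1) 0 g) (corner 1 1 g) = L * 2 * s * s ^+ n.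
    rewrite /volume (bigD1_ord k) //= !corner_k; congr (_ * _); first by ring.
    rewrite -[n in RHS]card_ord -prodr_const; apply: eq_bigr => j _.
    by rewrite !corner_lift addn0 addn1 -natr1; ring.
  rewrite esum_fset; last 2 first.
  + exact: finite_finset.
  + by move=> g _; rewrite vol_cell lee_fin !mulr_ge0 ?exprn_ge0 ?ltW.
  have -> : [set: {ffun 'I_n -> 'I_m.+1}] = [set` index_enum {ffun 'I_n -> 'I_m.+1}].
    by apply/seteqP; split => // g _ /=; rewrite mem_index_enum.
  rewrite -fsbig_seq ?index_enum_uniq //; under eq_bigr do rewrite vol_cell.
  rewrite sumEFin lee_fin sumr_const card_ffun !card_ord.
  have -> : L * 2 * s * s ^+ n *+ (m.+1 ^ n) = C * m.+1%:R^-1.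
    rewrite -mulr_natr natrX -mulrA -exprMn /C /s divfK //; ring.
  by rewrite mulrC -ler_pdivlMr // ltW.
Qed.

(** * Local structure of the common values *)

Lemma h_monotone_increment {R : realType} {n : nat} (h : 'rV[R]_n -> R)
    (T : 'rV[R]_n -> set 'rV[R]_n) (x y p p' : 'rV[R]_n) :
  h_monotone h T -> T x p -> T y p' ->
  h (x - p) - h (x - p') <= h (y - p) - h (y - p').
Proof.
move=> T_mono Txp Typ'.
have := T_mono x y p p' (ex_intro _ p Txp) (ex_intro _ p' Typ') Txp Typ'.
lra.
Qed.

(** If d is almost orthogonal to w and w_k <> 0, then d_k is controlled by the
    other coordinates: isolate w_k d_k in <w, d>, and absorb the half of
    |w_k| |d_k| that comes from the right-hand side. *)
Lemma lin_coord_bound {R : realType} {n : nat} (w d : 'rV[R]_n) (k : 'I_n) (D : R) :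
    w ord0 k != 0 ->
    `|\sum_(i < n) d ord0 i * w ord0 i| <= `|w ord0 k| / 2 * `|d| ->
    (forall i, i != k -> `|d ord0 i| <= D) -> 0 <= D ->
  `|d ord0 k| <=
    (1 + 2 * (\sum_(i < n | i != k) `|w ord0 i|) / `|w ord0 k|) * D.
Proof.
move=> wk_neq0 lin_le d_le D0.
have wk_gt0 : 0 < `|w ord0 k| by rewrite normr_gt0.
have d_norm : `|d| <= `|d ord0 k| + D.
  apply/row_norm_leP => [|i]; first by rewrite addr_ge0.
  have [->|/d_le di_le] := eqVneq i k; first by rewrite lerDl.
  by rewrite ler_wpDl.
move: lin_le; rewrite (bigD1 k) //=; set S := \sum_(i < n | i != k) d ord0 i * _ => lin_le.
have S_le : `|S| <= (\sum_(i < n | i != k) `|w ord0 i|) * D.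
  rewrite (le_trans (ler_norm_sum _ _ _)) // mulr_suml; apply: ler_sum => i ik.
  by rewrite normrM mulrC ler_wpM2l // d_le.
set W := \sum_(i < n | i != k) `|w ord0 i| in S_le *.
have prod_le : `|w ord0 k| * `|d ord0 k| <= `|w ord0 k| / 2 * `|d| + W * D.
  rewrite -normrM mulrC -[_ * _](addrK S) (le_trans (ler_normB _ _)) // lerD //.
rewrite -(ler_pM2l wk_gt0).
have -> : `|w ord0 k| * ((1 + 2 * W / `|w ord0 k|) * D) = `|w ord0 k| * D + 2 * (W * D).
  by field; exact: lt0r_neq0.
have : `|w ord0 k| / 2 * `|d| <= `|w ord0 k| / 2 * (`|d ord0 k| + D).
  by rewrite ler_wpM2l // divr_ge0.
lra.
Qed.

(** Here p1 need be a value only at x1, and p2 only at y2; when both are common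
    values, exchanging them gives the opposite inequality. *)
Lemma C1_near_collision {R : realType} {n : nat} (h : 'rV[R]_n -> R)
    (T : 'rV[R]_n -> set 'rV[R]_n) (p x y : 'rV[R]_n) (e : R) :
    C1 h -> h_monotone h T -> 0 < e ->
  exists2 r : R, 0 < r & forall p1 x1 p2 y2,
    `|p1 - p| < r -> `|x1 - x| < r -> `|p2 - p| < r -> `|y2 - y| < r ->
    T x1 p1 -> T y2 p2 ->
    dir_deriv h (x - p) (p2 - p1) - dir_deriv h (y - p) (p2 - p1) <= e * `|p2 - p1|.
Proof.
move=> h_C1 T_mono e0; have e2 : 0 < e / 2 by rewrite divr_gt0.
have [rx rx0 near_x] := C1_strict_diff h (x - p) _ h_C1 e2.
have [ry ry0 near_y] := C1_strict_diff h (y - p) _ h_C1 e2.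
exists (Num.min rx ry / 2) => [|p1 x1 p2 y2 pp1 xx1 pp2 yy2 T1 T2].
  by rewrite divr_gt0 // lt_min rx0.
have sub_near (q z c z0 : 'rV[R]_n) : `|q - c| < Num.min rx ry / 2 ->
    `|z - z0| < Num.min rx ry / 2 -> `|z - q - (z0 - c)| < Num.min rx ry.
  move=> qc zz; have -> : z - q - (z0 - c) = (z - z0) - (q - c) by rewrite !opprB addrACA [- q - z0]addrC addrACA.
  by rewrite (splitr (Num.min rx ry)) (le_lt_trans (ler_normB _ _)) // ltrD.
have diffE (z : 'rV[R]_n) : z - p1 - (z - p2) = p2 - p1.
  by rewrite opprB addrC subrKA.
have := h_monotone_increment h T x1 y2 p1 p2 T_mono T1 T2.
have := near_x (x1 - p1) (x1 - p2).
have := near_y (y2 - p1) (y2 - p2).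
rewrite !diffE.
have lt_minl (u : R) : u < Num.min rx ry -> u < rx by rewrite lt_min => /andP[].
have lt_minr (u : R) : u < Num.min rx ry -> u < ry by rewrite lt_min => /andP[].
move=> /(_ (lt_minr _ (sub_near _ _ _ _ pp1 yy2)) (lt_minr _ (sub_near _ _ _ _ pp2 yy2))).
move=> /ler_normlP[? ?].
move=> /(_ (lt_minl _ (sub_near _ _ _ _ pp1 xx1)) (lt_minl _ (sub_near _ _ _ _ pp2 xx1))).
move=> /ler_normlP[? ?] ?; lra.
Qed.

(** The slope eps := |w_k| / 2 is small enough for the difference w of the two
    gradients to bound the k-th coordinate of p2 - p1 by the others. *)
Lemma collision_locally_null {R : realType} {n : nat} (h : 'rV[R]_n -> R)
    (T : 'rV[R]_n -> set 'rV[R]_n) (p x y : 'rV[R]_n) (k : 'I_n) :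
    C1 h -> h_monotone h T -> partial k h (x - p) != partial k h (y - p) ->
  exists2 r : R, 0 < r & lebesgue_null
    [set p' | exists x' y', [/\ `|p' - p| < r, `|x' - x| < r, `|y' - y| < r, T x' p' & T y' p']].
Proof.
move=> h_C1 T_mono grad_neq.
pose w : 'rV[R]_n := \row_i (partial i h (x - p) - partial i h (y - p)).
have wk_neq0 : w ord0 k != 0 by rewrite mxE subr_eq0.
have wk_gt0 : 0 < `|w ord0 k| by rewrite normr_gt0.
have gradB d : dir_deriv h (x - p) d - dir_deriv h (y - p) d = \sum_(i < n) d ord0 i * w ord0 i.
  by rewrite -sumrB; apply: eq_bigr => i _; rewrite mxE mulrBr.
have e0 : 0 < `|w ord0 k| / 2 by rewrite divr_gt0.
have [r r0 r_near] := C1_near_collision h T p x y _ h_C1 T_mono e0.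
exists r => //.
apply: (@lipschitz_graph_null _ _ k (`|p| + r)
  (1 + 2 * (\sum_(i < n | i != k) `|w ord0 i|) / `|w ord0 k|)).
- by rewrite ltr_wpDl.
- by rewrite ltr_pwDl // divr_ge0 ?mulr_ge0 ?sumr_ge0.
- move=> p' [x' [y' [p'p _ _ _ _]]] i.
  apply: le_lt_trans (coord_norm_le _ i) _; rewrite -(subrK p p').
  by rewrite (le_lt_trans (ler_normD _ _)) // addrC ltrD2l.
move=> p1 p2 D [x1 [y1 [pp1 xx1 yy1 T1x T1y]]] [x2 [y2 [pp2 xx2 yy2 T2x T2y]]] D0 d_le.
apply: lin_coord_bound => //; rewrite -gradB; apply/ler_normlP; split.
  have := r_near p1 x1 p2 y2 pp1 xx1 pp2 yy2 T1x T2y.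
  rewrite -[p2 - p1]opprB normrN; apply: le_trans.
  by rewrite !gradB -sumrN; apply: ler_sum => i _; rewrite [in leRHS]mxE mulNr.
exact: r_near pp2 xx2 pp1 yy1 T2x T1y.
Qed.

(** * Common values form a null set *)

Theorem corollary3 (R : realType) (n : nat) (h : 'rV[R]_n -> R) (q : R)
    (T : 'rV[R]_n -> set 'rV[R]_n)
    (h_C2 : C2 h)
    (h_ge0 : forall x : 'rV[R]_n, 0 <= h x)
    (q_ge2 : 2 <= q)
    (h_hom : pos_homogeneous q h)
    (h_hess : forall x : 'rV[R]_n, unit_sphere x -> posdef (hessian h x))
    (T_mono : h_monotone h T) :
  lebesgue_null
    [set p : 'rV[R]_n | exists x y : 'rV[R]_n, x <> y /\ (T x `&` T y) p].
Proof.
have h_pos := posdef_hessian_off0 q h h_C2 h_hom h_hess.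
(* a witness of the common value p records p itself together with x and y *)
pose V := ('rV[R]_n * ('rV[R]_n * 'rV[R]_n))%type.
pose G (z : V) (p : 'rV[R]_n) := z.1 = p /\ z.2.1 <> z.2.2 /\ (T z.2.1 `&` T z.2.2) p.
have norm_lt (z : V) (r : R) :
    (`|z| < r) = [&& `|z.1| < r, `|z.2.1| < r & `|z.2.2| < r].
  by rewrite !prod_normE !gt_max.
apply: (@sub_lebesgue_null _ _ _ [set p | exists z, G z p]).
  by move=> p [x [y Tp]]; exists (p, (x, y)).
pose ratv := map_mx ratr : 'rV[rat]_n -> 'rV[R]_n.
apply: (locally_lebesgue_null
  (fun c : 'rV[rat]_n * ('rV[rat]_n * 'rV[rat]_n) =>
     (ratv c.1, (ratv c.2.1, ratv c.2.2)) : V)).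
  move=> [p [x y]] r r0.
  have [cp cpP] := rational_row_dense p r r0.
  have [cx cxP] := rational_row_dense x r r0.
  have [cy cyP] := rational_row_dense y r r0.
  by exists (cp, (cx, cy)); rewrite norm_lt; apply/and3P.
move=> [p [x y]] _ [/= _ [xy _]].
have [k grad_neq] : exists k, partial k h (x - p) != partial k h (y - p).
  apply: grad_injective => //; apply: contra_notN xy => /eqP.
  exact: addIr.
have [r r0 r_null] := collision_locally_null h T p x y k h_C2.1 T_mono grad_neq.
exists r => //; apply: sub_lebesgue_null r_null => p' [[p1 [x1 y1]]].
rewrite norm_lt /= => /and3P[pp xx yy] [/= <- [_ [Tx Ty]]].
by exists x1, y1; split => //; rewrite distrC.
Qed.
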